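(* Let $(M,d)$ be a compact metric space, $N\ge2$, let $\tau_i:M\to M$, $1\le i\le N$, be strict contractions, let $p_1,\dots,p_N>0$ with $\sum_{i=1}^N p_i=1$, and let $\mu$ be the associated IFS measure. Assume $\mu(\tau_i(M)\cap\tau_j(M))=0$ for $i\ne j$, and let $\sigma:M\to M$ satisfy $\sigma\circ\tau_i=id_M$ for all $i$ and $\sigma^{-1}(E)=\bigcup_{i=1}^N\tau_i(E)$ for all Borel $E\subset M$. For $f\in L^2(M,\mu)$ set $$S_if=\frac{1}{\sqrt{p_i}}\,\chi_{\tau_i(M)}\,(f\circ\sigma),\qquad S_i^*f=\sqrt{p_i}\,(f\circ\tau_i),\qquad 1\le i\le N.$$ Then the operators $\{S_i\}_{i=1}^N$, $\{S_i^*\}_{i=1}^N$ constitute a representation $\pi\in Rep(\mathcal{O}_N,L^2(\mu))$; that is, they are well-defined bounded operators on $L^2(\mu)$, $S_i^*$ is the adjoint of $S_i$, and $$S_i^*S_j=\delta_{ij}I,\qquad \sum_{i=1}^N S_iS_i^*=I .$$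
   Context: A map $\tau:M\to M$ is a strict contraction if there is $c<1$ with $d(\tau(x),\tau(y))\le c\,d(x,y)$ for all $x,y\in M$. The IFS measure $\mu$ associated with $(\{\tau_i\},\{p_i\})$ is the unique Borel probability measure on $M$ satisfying $\mu=\sum_{i=1}^N p_i\,\mu\circ\tau_i^{-1}$. $\chi_B$ denotes the indicator function of $B$. $Rep(\mathcal{O}_N,\mathscr{H})$ denotes the representations of the Cuntz algebra on $\mathscr{H}$, i.e. families $(S_i)_{i=1}^N$ of bounded operators with $S_i^*S_j=\delta_{ij}I$ and $\sum_iS_iS_i^*=I$. *)

(* Defs.v *)
From HB Require Import structures.
From mathcomp Require Import all_boot all_order all_algebra.
From mathcomp Require Import generic_quotient ring_quotient sesquilinear.
From mathcomp Require Import all_classical all_reals all_analysis.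
From mathcomp Require Import measurable_realfun complex.

Set Implicit Arguments.
Unset Strict Implicit.
Unset Printing Implicit Defensive.

Import Order.TTheory GRing.Theory Num.Theory.
Import numFieldNormedType.Exports.
Import ComplexField.Normc.

Local Open Scope classical_set_scope.
Local Open Scope ring_scope.

(* A measurableType is pointed in the library, hence so is a metric space that
   is to carry its Borel sigma-algebra. *)
#[short(type="pmetricType")]
HB.structure Definition PointedMetric (K : numDomainType) :=
  {M of PseudoPointedMetric K M & Metric K M}.

Notation borel T := (g_sigma_algebraType (@open T)).

Section complex_L2.
Context d (T : measurableType d) (R : realType).
Variable mu : {measure set T -> \bar R}.

Implicit Types (f g h : T -> R[i]) (a : R[i]).

(* Measurability into R[i] = R^2 is measurability of the two coordinates. *)
Definition square_integrable f : Prop :=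
  [/\ measurable_fun [set: T] (fun x => complex.Re (f x)),
      measurable_fun [set: T] (fun x => complex.Im (f x)) &
      finite_norm mu 2%:E (fun x => normc (f x))].

Definition sqint : {pred T -> R[i]} := mem [set f | square_integrable f].

Let ReF f : T -> R := fun x => complex.Re (f x).
Let ImF f : T -> R := fun x => complex.Im (f x).

Let le12 : (1 <= 2%:E :> \bar R)%E.
Proof. by rewrite lee_fin ler1n. Qed.

Let finite_norm2_le (f g : T -> R) :
  measurable_fun [set: T] f -> measurable_fun [set: T] g ->
  (forall x, `|f x| <= `|g x|) ->
  finite_norm mu 2%:E g -> finite_norm mu 2%:E f.
Proof.
move=> mf mg fg.
have mp (h : T -> R) : measurable_fun [set: T] h ->
    measurable_fun [set: T] (fun x => `|(h x)%:E| `^ 2)%E.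
  move=> mh; apply: (@measurableT_comp _ _ _ _ _ _ (fun x : \bar R => x `^ 2)%E
    _ (fun x => `|(h x)%:E|%E)).
    exact: measurable_poweR.
  exact/measurableT_comp/measurable_EFinP.
rewrite /finite_norm; apply: le_lt_trans; rewrite unlock.
rewrite gt0_ler_poweR//.
- by rewrite in_itv/= leey integral_ge0// => x _; exact: poweR_ge0.
- by rewrite in_itv/= leey integral_ge0// => x _; exact: poweR_ge0.
rewrite ge0_le_integral//.
- by move=> x _; exact: poweR_ge0.
- exact/mp.
- exact/mp.
- move=> x _ /=; rewrite lee_fin ge0_ler_powR ?nnegrE//.
Qed.

Let Lfun2E (f : T -> R) : f \in Lfun mu 2%:E <->
  measurable_fun [set: T] f /\ finite_norm mu 2%:E f.
Proof.
split; first by case/andP; rewrite !inE.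
by case=> mf ff; apply/andP; rewrite !inE.
Qed.

Let Re_le_normc (z : R[i]) : `|complex.Re z| <= `|normc z|.
Proof.
case: z => x y /=; rewrite [leRHS]ger0_norm ?sqrtr_ge0// -sqrtr_sqr.
by rewrite ler_wsqrtr// lerDl sqr_ge0.
Qed.

Let Im_le_normc (z : R[i]) : `|complex.Im z| <= `|normc z|.
Proof.
case: z => x y /=; rewrite [leRHS]ger0_norm ?sqrtr_ge0// -sqrtr_sqr.
by rewrite ler_wsqrtr// lerDr sqr_ge0.
Qed.

Let normcE (z : R[i]) :
  normc z = Num.sqrt (complex.Re z ^+ 2 + complex.Im z ^+ 2).
Proof. by case: z. Qed.

Let measurable_normc f : measurable_fun [set: T] (ReF f) ->
  measurable_fun [set: T] (ImF f) ->
  measurable_fun [set: T] (fun x => normc (f x)).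
Proof.
move=> mr mi; under eq_fun do rewrite normcE.
apply: (measurableT_comp (continuous_measurable_fun (@sqrt_continuous R))).
by apply: measurable_funD; exact: measurable_funX.
Qed.

Let sqintP f :
  f \in sqint <-> ReF f \in Lfun mu 2%:E /\ ImF f \in Lfun mu 2%:E.
Proof.
rewrite inE /=; split.
  move=> [mr mi fin]; have mn := measurable_normc mr mi.
  split; apply/Lfun2E; split=> //.
    by apply: finite_norm2_le fin => // x; exact: Re_le_normc.
  by apply: finite_norm2_le fin => // x; exact: Im_le_normc.
move=> [/[dup] /Lfun2E[mr _] lr /[dup] /Lfun2E[mi _] li].
have mn := measurable_normc mr mi; split=> //.
have : (fun x => `|ReF f x| + `|ImF f x|) \in Lfun mu 2%:E.
  have lnorm (g : T -> R) : g \in Lfun mu 2%:E ->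
      (fun x => `|g x|) \in Lfun mu 2%:E.
    move=> /Lfun2E[mg fg]; have mg' : measurable_fun setT (fun x => `|g x|).
      exact: measurableT_comp.
    apply/Lfun2E; split=> //.
    by apply: finite_norm2_le fg => // x; rewrite normr_id.
  have := (Lfun_addr_closed mu le12).2 _ _ (lnorm _ lr) (lnorm _ li).
  by [].
move=> /Lfun2E[mg]; apply: finite_norm2_le => // x.
rewrite normcE ger0_norm ?sqrtr_ge0// [leRHS]ger0_norm ?addr_ge0//.
rewrite -(@ler_pXn2r _ 2%N)// ?nnegrE ?sqrtr_ge0 ?addr_ge0//.
rewrite sqr_sqrtr ?addr_ge0 ?sqr_ge0// sqrrD !real_normK ?num_real//.
by rewrite lerD2r lerDl mulrn_wge0// mulr_ge0.
Qed.

Lemma sqint_Lfun f :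
  f \in sqint <-> (fun x => complex.Re (f x)) \in Lfun mu 2%:E /\
                 (fun x => complex.Im (f x)) \in Lfun mu 2%:E.
Proof. exact: sqintP. Qed.

Let sqint_submod_closed : submod_closed sqint.
Proof.
have [L0 LZD] := Lfun_submod_closed mu le12.
split; first by apply/sqintP; split; exact: L0.
move=> a f g /sqintP[fr fi] /sqintP[gr gi]; apply/sqintP; split.
- rewrite (_ : ReF _ = complex.Re a *: ReF f +
    ((- complex.Im a) *: ImF f + ReF g)); first by apply: (LZD) => //; exact: LZD.
  apply/funext => x; rewrite /ReF /ImF !fctE.
  by case: a (f x) (g x) => [ar ai] [zr zi] [wr wi] /=;
    rewrite -[_ *: zr]/(ar * zr) -[_ *: zi]/(- ai * zi) mulNr addrA.
- rewrite (_ : ImF _ = complex.Re a *: ImF f +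
    (complex.Im a *: ReF f + ImF g)); first by apply: (LZD) => //; exact: LZD.
  apply/funext => x; rewrite /ReF /ImF !fctE.
  by case: a (f x) (g x) => [ar ai] [zr zi] [wr wi] /=;
    rewrite -[_ *: zi]/(ar * zi) -[_ *: zr]/(ai * zr) addrA.
Qed.

HB.instance Definition _ :=
  GRing.isSubmodClosed.Build _ _ sqint sqint_submod_closed.

Record L2fun := L2Fun { L2val :> T -> R[i]; L2valP : L2val \in sqint }.

HB.instance Definition _ := [isSub for L2val].
HB.instance Definition _ := [Choice of L2fun by <:].
HB.instance Definition _ := [SubChoice_isSubLmodule of L2fun by <:].

Lemma L2valD (f g : L2fun) x : (f + g) x = f x + g x.
Proof. by []. Qed.

Lemma L2valZ a (f : L2fun) x : (a *: f) x = a * f x.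
Proof. by []. Qed.

Definition L2null : {pred L2fun} :=
  mem [set f : L2fun | {ae mu, forall x, f x = 0}].

Let L2null_submod_closed : submod_closed L2null.
Proof.
split; first by rewrite inE /=; apply/nearW.
move=> a f g; rewrite !inE /= => f0 g0.
apply: filterS2 f0 g0 => x fx gx.
rewrite -[LHS]/(a * f x + g x).
by rewrite fx gx mulr0 addr0.
Qed.

HB.instance Definition _ :=
  GRing.isSubmodClosed.Build _ _ L2null L2null_submod_closed.

Definition L2 : Type := {ideal_quot L2null}.
HB.instance Definition _ := GRing.Zmodule.on L2.
HB.instance Definition _ := EqQuotient.on L2.

Local Open Scope quotient_scope.

Definition L2class (f : L2fun) : L2 := \pi_L2 f.

(* In particular [f] is measurable and square integrable. *)
Definition L2represents f (u : L2) : Prop :=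
  exists2 g : L2fun, f = g :> (T -> R[i]) & L2class g = u.

Lemma L2classP (f g : L2fun) :
  L2class f = L2class g <-> {ae mu, forall x, f x = g x}.
Proof.
rewrite /L2class; split.
  move=> /eqP; rewrite -[_ == _]/(_ == _ %[mod {ideal_quot L2null}]).
  rewrite -Quotient.idealrBE inE /=; apply: filterS => x.
  by rewrite -[X in X = 0]/(f x - g x) => /eqP; rewrite subr_eq0 => /eqP.
move=> fg; apply/eqP; rewrite -[_ == _]/(_ == _ %[mod {ideal_quot L2null}]).
rewrite -Quotient.idealrBE inE /=; apply: filterS fg => x fgx.
by rewrite -[LHS]/(f x - g x) fgx subrr.
Qed.

Let reprE (f : L2fun) : {ae mu, forall x, (repr (L2class f) : L2fun) x = f x}.
Proof. by apply/L2classP; rewrite /L2class reprK. Qed.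

Definition L2scale a (u : L2) : L2 := L2class (a *: repr u).

Let L2classD (f g : L2fun) : L2class (f + g) = L2class f + L2class g.
Proof. exact: raddfD. Qed.

Let L2scale_class a (f : L2fun) : L2scale a (L2class f) = L2class (a *: f).
Proof.
apply/L2classP; apply: filterS (reprE f) => x fx.
by rewrite !L2valZ fx.
Qed.

Lemma L2ind (P : L2 -> Prop) : (forall f : L2fun, P (L2class f)) -> forall u, P u.
Proof. by move=> Pf u; rewrite -[u]reprK; exact: Pf. Qed.

Let L2scaleA a b u : L2scale a (L2scale b u) = L2scale (a * b) u.
Proof. by elim/L2ind: u => f; rewrite !L2scale_class scalerA. Qed.

Let L2scale1 : left_id 1 L2scale.
Proof. by elim/L2ind => f; rewrite L2scale_class scale1r. Qed.

Let L2scaleDr : right_distributive L2scale +%R.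
Proof.
by move=> a; elim/L2ind => f; elim/L2ind => g;
  rewrite -L2classD !L2scale_class -L2classD scalerDr.
Qed.

Let L2scaleDl u : {morph L2scale^~ u : a b / a + b}.
Proof.
by elim/L2ind: u => f a b; rewrite !L2scale_class -L2classD scalerDl.
Qed.

HB.instance Definition _ := GRing.Zmodule_isLmodule.Build R[i] L2
  L2scaleA L2scale1 L2scaleDr L2scaleDl.

Fact L2class_is_linear : linear L2class.
Proof. by move=> a f g; rewrite L2classD -L2scale_class. Qed.

HB.instance Definition _ :=
  GRing.isLinear.Build R[i] L2fun L2 _ L2class L2class_is_linear.

Definition Cintegral h : R[i] :=
  ((\int[mu]_x complex.Re (h x)) +i* (\int[mu]_x complex.Im (h x)))%C.

Definition L2dot (u v : L2) : R[i] :=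
  Cintegral (fun x => (repr u : L2fun) x * ((repr v : L2fun) x)^*%C).

Let cintegrable h :=
  mu.-integrable [set: T] (EFin \o ReF h) /\
  mu.-integrable [set: T] (EFin \o ImF h).

Let CintegralP a h k : cintegrable h -> cintegrable k ->
  Cintegral (fun x => a * h x + k x) = a * Cintegral h + Cintegral k.
Proof.
move=> [hr hi] [kr ki]; case: a => ar ai.
have lin (b c : R) (u v w : T -> R) : mu.-integrable [set: T] (EFin \o u) ->
    mu.-integrable [set: T] (EFin \o v) ->
    mu.-integrable [set: T] (EFin \o w) ->
    \int[mu]_x (b * u x + (c * v x + w x)) =
    b * (\int[mu]_x u x) + (c * (\int[mu]_x v x) + \int[mu]_x w x).
  move=> iu iv iw.
  have iZ (t : R) (z : T -> R) : mu.-integrable [set: T] (EFin \o z) ->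
      mu.-integrable [set: T] (EFin \o (fun x => t * z x)).
    by move=> iz; exact: (integrableZl measurableT t iz).
  rewrite RintegralD ?RintegralD ?RintegralZl//; try exact: iZ.
  rewrite (_ : _ \o _ = (EFin \o (fun x => c * v x)%R) \+ (EFin \o w))%E//.
  by apply: integrableD => //; exact: iZ.
rewrite /Cintegral -[RHS]/(Complex (_ - _ + _) (_ + _ + _)); congr (_ +i* _)%C.
- rewrite -addrA -mulNr -lin//; apply: eq_Rintegral => x _.
  by case: (h x) (k x) => [? ?] [? ?] /=; rewrite mulNr addrA.
- rewrite -addrA -lin//; apply: eq_Rintegral => x _.
  by case: (h x) (k x) => [? ?] [? ?] /=; rewrite addrA.
Qed.

Let Re_mul_conj (z w : R[i]) : complex.Re (z * w^*%C) =
  complex.Re z * complex.Re w + complex.Im z * complex.Im w.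
Proof. by case: z w => [? ?] [? ?] /=; rewrite mulrN opprK. Qed.

Let Im_mul_conj (z w : R[i]) : complex.Im (z * w^*%C) =
  - (complex.Re z * complex.Im w) + complex.Im z * complex.Re w.
Proof. by case: z w => [? ?] [? ?] /=; rewrite mulrN. Qed.

Let mul_conjc (z w : R[i]) : z * w^*%C = (w * z^*%C)^*%C.
Proof.
case: z w => [z1 z2] [w1 w2]; apply/eqP; rewrite eq_complex /=.
rewrite !mulrN !opprK opprD opprK ![w1 * _]mulrC ![w2 * _]mulrC eqxx /=.
by rewrite addrC.
Qed.

Let mul_conjc_self (z : R[i]) : z * z^*%C = (normc z ^+ 2)%:C%C.
Proof.
apply/eqP; rewrite eq_complex Re_mul_conj Im_mul_conj /= normcE.
by rewrite sqr_sqrtr ?addr_ge0 ?sqr_ge0// -!expr2 eqxx mulrC addNr eqxx.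
Qed.

Let cintegrable_dot (f g : L2fun) : cintegrable (fun x => f x * (g x)^*%C).
Proof.
have /sqintP[fr fi] := L2valP f; have /sqintP[gr gi] := L2valP g.
have [_ LZD] := Lfun_submod_closed mu (lexx 1%E).
split; apply/Lfun1_integrable.
- rewrite (_ : ReF _ = 1 *: (ReF f \* ReF g) + (ImF f \* ImF g)); last first.
    apply/funext => x; rewrite /ReF /ImF scale1r !fctE.
    exact: Re_mul_conj.
  by apply: LZD; exact: Lfun2_mul_Lfun1.
- rewrite (_ : ImF _ = (-1) *: (ReF f \* ImF g) + (ImF f \* ReF g)); last first.
    apply/funext => x; rewrite /ReF /ImF scaleN1r !fctE.
    exact: Im_mul_conj.
  by apply: LZD; exact: Lfun2_mul_Lfun1.
Qed.

Lemma L2dotE (f g : L2fun) :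
  L2dot (L2class f) (L2class g) = Cintegral (fun x => f x * (g x)^*%C).
Proof.
have fg := cintegrable_dot f g.
have fg' := cintegrable_dot (repr (L2class f)) (repr (L2class g)).
have ae : {ae mu, forall x, (repr (L2class f) : L2fun) x *
    ((repr (L2class g) : L2fun) x)^*%C = f x * (g x)^*%C}.
  by apply: filterS2 (reprE f) (reprE g) => x -> ->.
rewrite /L2dot /Cintegral; congr (_ +i* _)%C; rewrite /Rintegral; congr fine.
- apply: ae_eq_integral => //.
  + exact: measurable_int fg'.1.
  + exact: measurable_int fg.1.
  + by apply: filterS ae => x + _ => ->.
- apply: ae_eq_integral => //.
  + exact: measurable_int fg'.2.
  + exact: measurable_int fg.2.
  + by apply: filterS ae => x + _ => ->.
Qed.

Let CintegralC h : cintegrable h -> Cintegral (fun x => (h x)^*%C) = (Cintegral h)^*%C.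
Proof.
move=> [_ hi]; rewrite /Cintegral /=; congr (_ +i* _)%C.
  by apply: eq_Rintegral => x _; case: (h x).
rewrite -mulN1r -RintegralZl//; apply: eq_Rintegral => x _.
by case: (h x) => ? ? /=; rewrite mulN1r.
Qed.


Let L2dotPl a (u v w : L2) :
  L2dot (a *: u + v) w = a * L2dot u w + L2dot v w.
Proof.
elim/L2ind: u => f; elim/L2ind: v => g; elim/L2ind: w => h.
rewrite -linearP !L2dotE -CintegralP; try exact: cintegrable_dot.
by congr Cintegral; apply/funext => x; rewrite L2valD L2valZ mulrDl mulrA.
Qed.

Let L2dot_conj (u v : L2) : L2dot u v = Num.conj (L2dot v u).
Proof.
elim/L2ind: u => f; elim/L2ind: v => g.
rewrite !L2dotE; transitivity ((Cintegral (fun x => g x * (f x)^*%C))^*%C) => //.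
rewrite -CintegralC; last exact: cintegrable_dot.
congr Cintegral; apply/funext => x.
exact: mul_conjc.
Qed.

Let L2dot_sesqui : bilinear_for *%R (Num.conj \; *%R) L2dot.
Proof.
split=> [w a u v|u a v w] /=; first exact: L2dotPl.
by rewrite L2dot_conj L2dotPl rmorphD rmorphM /= -!L2dot_conj.
Qed.

HB.instance Definition _ := bilinear_isBilinear.Build R[i] L2 L2 R[i]
  *%R (Num.conj \; *%R) L2dot L2dot_sesqui.

Let L2dot_herm (u v : L2) : L2dot u v = (-1) ^+ false * Num.conj (L2dot v u).
Proof.
by rewrite mul1r L2dot_conj.
Qed.

HB.instance Definition _ := isHermitianSesquilinear.Build R[i] L2 false Num.conj
  L2dot L2dot_herm.

Let L2dot_pos (u : L2) : u != 0 -> 0 < L2dot u u.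
Proof.
elim/L2ind: u => f f0; rewrite L2dotE.
have [ir ii] := cintegrable_dot f f.
have fE x : f x * (f x)^*%C = (normc (f x) ^+ 2)%:C%C by exact: mul_conjc_self.
have in2 : mu.-integrable [set: T] (fun x => (normc (f x) ^+ 2)%:E).
  by move: ir; congr integrable; apply/funext => x /=; rewrite /ReF fE.
have -> : Cintegral (fun x => f x * (f x)^*%C) =
    (\int[mu]_x (normc (f x) ^+ 2))%:C%C.
  rewrite /Cintegral; congr Complex.
    by apply: eq_Rintegral => x _; rewrite fE.
  rewrite (@eq_Rintegral _ _ _ _ _ (fun x => 0 * normc (f x) ^+ 2)).
    by rewrite RintegralZl// mul0r.
  by move=> x _; rewrite fE mul0r.
rewrite ltcR lt_neqAle Rintegral_ge0 ?andbT//; last by move=> x _; exact: sqr_ge0.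
apply: contra f0 => /eqP/esym i0; apply/eqP.
rewrite -(raddf0 (L2class : {linear L2fun -> L2})); apply/L2classP.
have : (\int[mu]_x `|(normc (f x) ^+ 2)%:E| = 0)%E.
  under eq_integral do rewrite gee0_abs ?lee_fin ?sqr_ge0//.
  by rewrite -[LHS]fineK ?integrable_fin_num//; congr EFin.
move=> /(ae_eq_integral_abs mu measurableT (measurable_int _ in2)).
apply: filterS => x /(_ I) [] /eqP; rewrite sqrf_eq0 => /eqP.
exact: eq0_normc.
Qed.

HB.instance Definition _ := isDotProduct.Build R[i] L2 L2dot L2dot_pos.
End complex_L2.

Arguments L2represents {d T R} mu f u.
Arguments L2dot {d T R} mu u v.

Section cuntz_representation.
Context (C : numClosedFieldType) (H : lmodType C).
Variable dot : {dot H for Num.conj}.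

Definition dot_norm (u : H) : C := sqrtC (dot u u).

Definition bounded_operator (A : {linear H -> H}) : Prop :=
  exists K : C, forall u, dot_norm (A u) <= K * dot_norm u.

Definition is_adjoint (A B : {linear H -> H}) : Prop :=
  forall u v, dot (A u) v = dot u (B v).

(* [T i] is the adjoint of [S i]; it is an argument because an inner product
   space that is not known to be complete has no total adjoint operation. *)
Record cuntz_rep N (S T : 'I_N -> {linear H -> H}) : Prop := CuntzRep {
  cuntz_bounded : forall i, bounded_operator (S i);
  cuntz_adj_bounded : forall i, bounded_operator (T i);
  cuntz_adjoint : forall i, is_adjoint (S i) (T i);
  cuntz_orthogonal : forall i j u, T i (S j u) = (i == j)%:R *: u;
  cuntz_complete : forall u, \sum_(i < N) S i (T i u) = u }.

End cuntz_representation.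

Section iterated_function_system.
Context (R : realType) (M : pmetricType R).

Definition strict_contraction (t : M -> M) : Prop :=
  exists2 c : R, c < 1 & forall x y, mdist (t x) (t y) <= c * mdist x y.

Context (N : nat) (tau : 'I_N -> M -> M) (p : 'I_N -> R) (sigma : M -> M).

(* For strict contractions of a compact space there is exactly one such [mu]
   (Hutchinson), so uniqueness is not repeated here. *)
Definition ifs_measure (mu : probability (borel M) R) : Prop :=
  forall A : set (borel M), measurable A ->
    mu A = (\sum_(i < N) (p i)%:E *
      pushforward mu (tau i : borel M -> borel M) A)%E.

Definition ifs_S (i : 'I_N) (f : M -> R[i]) : M -> R[i] :=
  fun x => (1 / Num.sqrt (p i))%:C%C * (\1_(range (tau i)) x)%:C%C * f (sigma x).

Definition ifs_Sadj (i : 'I_N) (f : M -> R[i]) : M -> R[i] :=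
  fun x => (Num.sqrt (p i))%:C%C * f (tau i x).

End iterated_function_system.

(* Main.v *)
Require Import Defs.
From HB Require Import structures.
From mathcomp Require Import all_boot all_order all_algebra.
From mathcomp Require Import all_classical all_reals all_analysis.
From mathcomp Require Import measurable_realfun complex.
From mathcomp Require Import sesquilinear ring.

Import Order.TTheory GRing.Theory Num.Theory.
Import numFieldNormedType.Exports.

Local Open Scope classical_set_scope.
Local Open Scope ring_scope.

(** The whole proof rests on one change of variables. Write the invariance of
    [mu] as [mu A = \sum_k p k * mu (tau k @^-1` A)]. Applied to the overlap of
    the ranges of [tau i] and [tau j], it shows that [tau j] sends almost no
    point into the range of [tau i] when [j != i]; applied to the part of [A]
    lying in the range of [tau i], only the term [k = i] then survives, so that
    [mu (A `&` range (tau i)) = p i * mu (tau i @^-1` A)]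
    ([tau_parametrizes]). Applied to [sigma @^-1` A], it gives, since
    [sigma \o tau k = id] and the [p k] add up to [1], that [sigma] preserves
    [mu] ([sigma_parametrizes]). Both are instances of one notion,
    [parametrizes mu phi c D]: the map [phi] carries [c * mu] to the restriction
    of [mu] to [D].

    Such a [phi] pulls almost everywhere statements back and satisfies
    [\int_D u = c * \int (u \o phi)]. Hence multiplying [f \o phi] by a bounded
    weight defines a linear operator on square integrable functions which
    passes to classes ([weighted_comp_L2]); the operators [S i] and [S i]^* are
    of this form, over [sigma] and over [tau i].

    Adjointness is the change of variables for [tau i] applied to
    [f \o sigma] times the conjugate of [g] ([dot_parametrizes]). The relation
    [S i]^* [S j] = [delta i j] holds pointwise for [i = j], and for [i <> j]
    because [tau i x] is almost never in the range of [tau j]. The sum of the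
    [S i] [S i]^* [f] is, at [x], the sum of [f (tau i (sigma x))] over the [i]
    whose range contains [x]; the ranges cover the space and almost every [x]
    lies in exactly one of them, where the term is [f x]. Boundedness
    comes last and for free: it is a formal consequence of these relations
    ([cuntz_rep_of_relations]).

    The measurability that all this presupposes comes from compactness: the
    [tau i] are continuous maps of a compact Hausdorff space, hence closed, so
    their ranges are closed, and [sigma], whose preimages of closed sets are
    finite unions of images by the [tau i], is continuous. *)

Set Implicit Arguments.
Unset Strict Implicit.

(** * The Cuntz relations imply boundedness *)

Section cuntz_relations.
Context (C : numClosedFieldType) (H : lmodType C).
Variables (dot : {dot H for Num.conj}) (N : nat).
Variables S T : 'I_N -> {linear H -> H}.
Hypothesis adjST : forall i, is_adjoint dot (S i) (T i).
Hypothesis orthTS : forall i j u, T i (S j u) = (i == j)%:R *: u.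
Hypothesis complST : forall u, \sum_(i < N) S i (T i u) = u.

Lemma cuntz_isometry i u : dot (S i u) (S i u) = dot u u.
Proof. by rewrite adjST orthTS eqxx scale1r. Qed.

Lemma cuntz_parseval u : dot u u = \sum_(i < N) dot (T i u) (T i u).
Proof.
transitivity (dot (\sum_(i < N) S i (T i u)) u); first by rewrite complST.
by rewrite linear_sumlz /=; apply: eq_bigr => i _; exact: adjST.
Qed.

(** The [S i] are isometries, and each [T i] is a contraction because its square
    norm is one of the nonnegative terms of Parseval's identity; so [1] bounds
    all these operators. *)
Lemma cuntz_rep_of_relations : cuntz_rep dot S T.
Proof.
have norm_le (A : {linear H -> H}) :
    (forall u, dot (A u) (A u) <= dot u u) -> bounded_operator dot A.
  move=> leA; exists 1 => u; rewrite mul1r /dot_norm.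
  by rewrite ler_sqrtC ?qualifE /= ?dnorm_ge0.
split => // i; apply: norm_le => u; first by rewrite cuntz_isometry.
rewrite [leRHS]cuntz_parseval (bigD1 i)//= lerDl sumr_ge0// => j _.
Qed.

End cuntz_relations.

(** * Square integrable functions and operators on their classes *)

Section L2_operators.
Context d (T : measurableType d) (R : realType).
Variable mu : {measure set T -> \bar R}.

Lemma Lfun2P (f : T -> R) : f \in Lfun mu 2%:E <->
  measurable_fun [set: T] f /\ (\int[mu]_x (f x ^+ 2)%:E < +oo)%E.
Proof.
split=> [f2|[mf fi]].
  split; first by have /andP[+ _] := f2; rewrite inE.
  have /integrableP[_] := Lfun2_integrable_sqr f2.
  by under eq_integral do rewrite /= ger0_norm ?sqr_ge0//.
apply/andP; rewrite !inE; split=> //=.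
rewrite /finite_norm unlock; apply: poweR_lty; move: fi.
apply: le_lt_trans; rewrite le_eqVlt; apply/orP; left; apply/eqP.
apply: eq_integral => x _ /=.
by rewrite powR_mulrn// real_normK// num_real.
Qed.

Lemma Lfun2_le (f g : T -> R) : measurable_fun [set: T] f ->
  (forall x, `|f x| <= `|g x|) -> g \in Lfun mu 2%:E -> f \in Lfun mu 2%:E.
Proof.
move=> mf fg /Lfun2P[mg gi]; apply/Lfun2P; split=> //.
apply: le_lt_trans gi; apply: ge0_le_integral => //.
- by move=> x _; rewrite lee_fin sqr_ge0.
- by apply/measurable_EFinP; exact: measurable_funX.
- by apply/measurable_EFinP; exact: measurable_funX.
- by move=> x _; rewrite lee_fin -ler_sqrt ?sqr_ge0// !sqrtr_sqr.
Qed.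

Lemma Lfun2_mul_bounded (w u : T -> R) (K : R) : measurable_fun [set: T] w ->
  (forall x, `|w x| <= K) -> u \in Lfun mu 2%:E ->
  (fun x => w x * u x) \in Lfun mu 2%:E.
Proof.
move=> mw wK u2; have [mu_ _] := (Lfun2P u).1 u2.
have K0 : 0 <= K by exact: le_trans (wK point).
apply: (@Lfun2_le _ (K *: u)); first exact: measurable_funM.
  by move=> x; rewrite -[(_ *: _) x]/(K * u x) !normrM (ger0_norm K0) ler_wpM2r.
have le12 : (1 <= 2%:E :> \bar R)%E by rewrite lee_fin ler1n.
have [L0 LZD] := Lfun_submod_closed mu le12.
by rewrite -[K *: u]addr0; exact: LZD.
Qed.

(** Linearity reduces compatibility with almost everywhere equality to the
    preservation of null functions. *)
Lemma L2_lift (W : {linear L2fun mu -> L2fun mu}) :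
  (forall f : L2fun mu, {ae mu, forall x, f x = 0} ->
     {ae mu, forall x, W f x = 0}) ->
  exists A : {linear L2 mu -> L2 mu}, forall f,
    A (L2class f) = L2class (W f).
Proof.
move=> W0.
have W_compat (f g : L2fun mu) : L2class f = L2class g ->
    L2class (W f) = L2class (W g).
  move=> /L2classP fg; apply/L2classP.
  have /W0 : {ae mu, forall x, (f - g) x = 0}.
    by apply: filterS fg => x fgx; rewrite -[LHS]/(f x - g x) fgx subrr.
  rewrite linearB; apply: filterS => x.
  by rewrite -[X in X = 0]/(W f x - W g x) => /eqP; rewrite subr_eq0 => /eqP.
pose A (u : L2 mu) : L2 mu := L2class (W (repr u)).
have AE f : A (L2class f) = L2class (W f) by apply: W_compat; exact: reprK.
have A_linear : linear A.
  move=> a; elim/L2ind => f; elim/L2ind => g.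
  by rewrite -linearP !AE linearP linearP.
pose A_lin := GRing.isLinear.Build R[i] (L2 mu) (L2 mu) _ A A_linear.
by exists (HB.pack_for {linear L2 mu -> L2 mu} A A_lin).
Qed.

Lemma integrable_dot (f g : L2fun mu) :
  mu.-integrable [set: T] (fun x => (complex.Re (f x * (g x)^*%C))%:E) /\
  mu.-integrable [set: T] (fun x => (complex.Im (f x * (g x)^*%C))%:E).
Proof.
have /sqint_Lfun[fr fi] := L2valP f; have /sqint_Lfun[gr gi] := L2valP g.
have mulI (u v : T -> R) : u \in Lfun mu 2%:E -> v \in Lfun mu 2%:E ->
    mu.-integrable [set: T] (fun x => (u x * v x)%:E).
  by move=> u2 v2; apply/Lfun1_integrable; exact: Lfun2_mul_Lfun1.
split.
- have := integrableD measurableT (mulI _ _ fr gr) (mulI _ _ fi gi).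
  apply: eq_integrable => //.
  move=> x _ /=; rewrite -EFinD; congr EFin.
  by case: (f x) (g x) => [? ?] [? ?] /=; rewrite mulrN opprK.
- have := integrableB measurableT (mulI _ _ fi gr) (mulI _ _ fr gi).
  apply: eq_integrable => //.
  move=> x _ /=; rewrite -EFinB; congr EFin.
  by case: (f x) (g x) => [? ?] [? ?] /=; rewrite mulrN addrC.
Qed.

End L2_operators.

(** * Change of variables along a map onto a part of the space *)

Section change_of_variables.
Context d (T : measurableType d) (R : realType).
Variable mu : {measure set T -> \bar R}.

(** [phi] carries the measure [c * mu] to the restriction of [mu] to [D]. For an
    iterated function system this holds of [tau i] with [c = p i] and [D] the
    range of [tau i], and of [sigma] with [c = 1] and [D] the whole space. *)
Definition parametrizes (phi : T -> T) (c : R) (D : set T) : Prop :=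
  [/\ measurable_fun [set: T] phi, measurable D, (forall x, D (phi x)), 0 < c &
    forall A, measurable A -> mu (A `&` D) = (c%:E * mu (phi @^-1` A))%E].

Section parametrization.
Variables (phi : T -> T) (c : R) (D : set T).
Hypothesis par : parametrizes phi c D.

(** A null set [N] has a null preimage: [c] times the measure of the preimage is
    the measure of a part of [N], and [c] does not vanish. *)
Lemma ae_parametrizes (P : T -> Prop) :
  {ae mu, forall x, P x} -> {ae mu, forall x, P (phi x)}.
Proof.
have [mphi mD Dphi c0 muE] := par.
move=> [N [mN N0 PN]]; exists (phi @^-1` N); split.
- by rewrite -[X in measurable X]setTI; exact: mphi.
- have : (c%:E * mu (phi @^-1` N) = 0)%E.
    rewrite -muE//; apply/eqP; rewrite -measure_le0 -N0.
    by apply: le_measure; rewrite ?inE//; exact: measurableI.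
  by move=> /eqP; rewrite mule_eq0 eqe (gt_eqF c0)/= => /eqP.
- by move=> x; exact: PN.
Qed.

Lemma ge0_integral_parametrizes (u : T -> \bar R) :
  measurable_fun [set: T] u -> (forall x, 0 <= u x)%E ->
  (\int[mu]_(x in D) u x = c%:E * \int[mu]_x u (phi x))%E.
Proof.
have [mphi mD Dphi c0 muE] := par.
move=> mu_ u0.
pose k : {nonneg R} := NngNum (ltW c0).
(* The two measures agree on the subsets of [D], and [phi] takes its values
   in [D], so the integral of the pulled back function is over all of [T]. *)
pose nu : {measure set T -> \bar R} := mscale k (pushforward mu phi).
rewrite (eq_measure_integral (nu mphi)); last first.
  by move=> A mA AD; rewrite -[in LHS](setIidl AD) muE.
rewrite ge0_integral_mscale//; last exact: measurable_funTS.
rewrite ge0_integral_pushforward//; last exact: measurable_funTS.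
congr (_ * integral _ _ _)%E.
by apply/seteqP; split => // x _; exact: Dphi.
Qed.

Lemma Rintegral_parametrizes (u : T -> R) : measurable_fun [set: T] u ->
  mu.-integrable [set: T] (fun x => (u (phi x))%:E) ->
  \int[mu]_x (\1_D x * u x) = c * \int[mu]_x u (phi x).
Proof.
have [mphi mD Dphi c0 muE] := par.
move=> mu_ iu; rewrite /Rintegral.
have -> : (\int[mu]_x (\1_D x * u x)%:E = \int[mu]_(x in D) (u x)%:E)%E.
  rewrite [RHS]integral_mkcond; apply: eq_integral => x _.
  by rewrite patchE indicE; case: ifPn => _; rewrite ?mul1r ?mul0r.
have mEu : measurable_fun [set: T] (EFin \o u) by exact/measurable_EFinP.
have -> : (\int[mu]_(x in D) (u x)%:E = c%:E * \int[mu]_x (u (phi x))%:E)%E.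
  have ip := integrable_funepos measurableT iu.
  have im := integrable_funeneg measurableT iu.
  have pE : (fun x => (u (phi x))%:E)^\+%E = (EFin \o u)^\+%E \o phi
    by exact: funepos_comp (EFin \o u) phi.
  have nE : (fun x => (u (phi x))%:E)^\-%E = (EFin \o u)^\-%E \o phi
    by exact: funeneg_comp (EFin \o u) phi.
  rewrite pE in ip; rewrite nE in im.
  rewrite integralE [in RHS]integralE pE nE.
  rewrite !ge0_integral_parametrizes//.
  - rewrite [RHS]muleBr//; apply: fin_num_adde_defl; rewrite fin_numN.
    exact: integrable_fin_num.
  - exact: measurable_funeneg.
  - exact: measurable_funepos.
by rewrite fineM//; exact: integrable_fin_num.
Qed.

Lemma Lfun2_parametrizes (u : T -> R) :
  u \in Lfun mu 2%:E -> u \o phi \in Lfun mu 2%:E.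
Proof.
have [mphi mD Dphi c0 muE] := par.
move=> /Lfun2P[mu_ iu]; apply/Lfun2P; split; first exact: measurableT_comp.
have msq : measurable_fun [set: T] (fun x => (u x ^+ 2)%:E).
  by apply/measurable_EFinP; exact: measurable_funX.
have : (c%:E * \int[mu]_x (u (phi x) ^+ 2)%:E < +oo)%E.
  rewrite -(@ge0_integral_parametrizes (fun x => (u x ^+ 2)%:E))//; last first.
    by move=> x; rewrite lee_fin sqr_ge0.
  apply: le_lt_trans iu; apply: ge0_subset_integral => //.
  by move=> x _; rewrite lee_fin sqr_ge0.
by rewrite -lte_pdivlMl// mulry gtr0_sg ?invr_gt0// mul1e.
Qed.

Lemma Cintegral_parametrizes (h : T -> R[i]) :
  measurable_fun [set: T] (fun x => complex.Re (h x)) ->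
  measurable_fun [set: T] (fun x => complex.Im (h x)) ->
  mu.-integrable [set: T] (fun x => (complex.Re (h (phi x)))%:E) ->
  mu.-integrable [set: T] (fun x => (complex.Im (h (phi x)))%:E) ->
  Cintegral mu (fun x => (\1_D x)%:C%C * h x) =
  c%:C%C * Cintegral mu (fun x => h (phi x)).
Proof.
move=> mr mi ir ii; rewrite /Cintegral -[RHS]/(Complex (_ - _) (_ + _)).
rewrite !mul0r subr0 addr0.
rewrite -(@Rintegral_parametrizes (fun x => complex.Re (h x)))//.
rewrite -(@Rintegral_parametrizes (fun x => complex.Im (h x)))//.
congr Complex; apply: eq_Rintegral => x _; case: (h x) => ? ? /=.
  by rewrite mul0r subr0.
by rewrite mul0r addr0.
Qed.

Section weighted_composition.
Variable w : T -> R.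
Hypotheses (mw : measurable_fun [set: T] w).
Variable K : R.
Hypothesis wK : forall x, `|w x| <= K.

Lemma weighted_comp_sqint (f : L2fun mu) :
  (fun x => (w x)%:C%C * f (phi x)) \in sqint mu.
Proof.
have /sqint_Lfun[fr fi] := L2valP f.
have wr := Lfun2_mul_bounded mw wK (Lfun2_parametrizes fr).
have wi := Lfun2_mul_bounded mw wK (Lfun2_parametrizes fi).
apply/sqint_Lfun; split.
- suff -> : (fun x => complex.Re ((w x)%:C%C * f (phi x))) =
      (fun x => w x * complex.Re (f (phi x))) by [].
  by apply/funext => x; case: (f (phi x)) => ? ? /=; rewrite mul0r subr0.
- suff -> : (fun x => complex.Im ((w x)%:C%C * f (phi x))) =
      (fun x => w x * complex.Im (f (phi x))) by [].
  by apply/funext => x; case: (f (phi x)) => ? ? /=; rewrite mul0r addr0.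
Qed.

(** Both [S i] (over [sigma], with a multiple of an indicator function as weight)
    and its adjoint (over [tau i], with a constant weight) are operators of this
    form. *)
Lemma weighted_comp_L2 : exists A : {linear L2 mu -> L2 mu},
  forall f : L2fun mu,
    L2represents mu (fun x => (w x)%:C%C * f (phi x)) (A (L2class f)).
Proof.
pose W f := L2Fun (weighted_comp_sqint f).
have W_linear : linear W.
  move=> a f g; apply/val_inj/funext => x.
  rewrite -[LHS]/((w x)%:C%C * (a * f (phi x) + g (phi x))).
  rewrite -[RHS]/(a * ((w x)%:C%C * f (phi x)) + (w x)%:C%C * g (phi x)).
  by rewrite mulrDr mulrCA.
pose W_lin := GRing.isLinear.Build R[i] (L2fun mu) (L2fun mu) _ W W_linear.
have [|A AE] :=
  @L2_lift _ _ _ mu (HB.pack_for {linear L2fun mu -> L2fun mu} W W_lin).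
  move=> f f0; apply: filterS (ae_parametrizes f0) => x fx0.
  by rewrite -[LHS]/((w x)%:C%C * f (phi x)) fx0 mulr0.
by exists A => f; exists (W f).
Qed.

End weighted_composition.
(** The integrability required by the change of variables is that of a product
    of two square integrable functions, since [f \o phi] and [g \o phi] are again
    square integrable. *)
Lemma dot_parametrizes (f g : L2fun mu) :
  Cintegral mu (fun x => (\1_D x)%:C%C * (f x * (g x)^*%C)) =
  c%:C%C * Cintegral mu (fun x => f (phi x) * (g (phi x))^*%C).
Proof.
have pull (k : L2fun mu) : exists k' : L2fun mu, forall x, k' x = k (phi x).
  have one_le (x : T) : `|cst (1 : R) x| <= 1 by rewrite normr1.
  have m1 : measurable_fun [set: T] (cst (1 : R)) by exact: measurable_cst.
  exists (L2Fun (weighted_comp_sqint m1 one_le k)) => x.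
  by rewrite -[LHS]/((1 : R)%:C%C * k (phi x)) mul1r.
have [[f' f'E] [g' g'E]] := (pull f, pull g).
have [ir ii] := integrable_dot f g.
have [ir' ii'] := integrable_dot f' g'.
rewrite (@Cintegral_parametrizes (fun x => f x * (g x)^*%C))//.
- exact/measurable_EFinP/(measurable_int _ ir).
- exact/measurable_EFinP/(measurable_int _ ii).
- by move: ir'; congr integrable; apply/funext => x; rewrite f'E g'E.
- by move: ii'; congr integrable; apply/funext => x; rewrite f'E g'E.
Qed.

End parametrization.
End change_of_variables.

(** * Borel measurability of continuous maps *)

Section borel_topology.
Context (T : ptopologicalType).

Lemma closed_borel_measurable (A : set (borel T)) :
  closed (A : set T) -> measurable A.
Proof.
move=> cA; rewrite -[A]setCK; apply: measurableC.
by apply: sub_sigma_algebra; exact: closed_openC.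
Qed.

Lemma continuous_borel_measurable (f : T -> T) :
  continuous f -> measurable_fun [set: borel T] (f : borel T -> borel T).
Proof.
move=> /continuousP cf.
apply: (@measurability _ _ (borel T) (borel T) setT f (@open T)) => //.
move=> _ [A oA <-]; rewrite setTI.
by apply: sub_sigma_algebra; exact: cf.
Qed.

End borel_topology.

(** * The measure of an iterated function system *)

Section iterated_function_system_operators.
Context (R : realType) (M : pmetricType R).

Lemma strict_contraction_continuous (t : M -> M) :
  strict_contraction t -> continuous t.
Proof.
move=> [c c1 tc] x; apply/metricType_numDomainType.cvgrPdist_lt => e e0.
have /metricType_numDomainType.cvgrPdist_lt/(_ e e0) : id @ x --> x by [].
apply: filterS => y; apply: le_lt_trans; apply: le_trans (tc x y) _.
by rewrite ler_piMl// ?mdist_ge0// ltW.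
Qed.

Context (N : nat) (tau : 'I_N -> M -> M) (p : 'I_N -> R) (sigma : M -> M).
Variable mu : probability (borel M) R.
Hypothesis compactM : compact [set: M].
Hypothesis contr : forall i, strict_contraction (tau i).
Hypothesis p_gt0 : forall i, 0 < p i.
Hypothesis sum_p : \sum_(i < N) p i = 1.
Hypothesis ifs_mu : ifs_measure tau p mu.
Hypothesis overlap0 :
  forall i j, i != j -> mu (range (tau i) `&` range (tau j)) = 0%E.
Hypothesis sigmaK : forall i, sigma \o tau i = id.
Hypothesis sigma_preimage : forall E : set (borel M), measurable E ->
  sigma @^-1` E = \bigcup_(i in [set: 'I_N]) (tau i @` E).

Lemma tau_measurable i :
  measurable_fun [set: borel M] (tau i : borel M -> borel M).
Proof.
by apply: continuous_borel_measurable; exact: strict_contraction_continuous.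
Qed.

Lemma tau_image_closed i (A : set M) : closed A -> closed (tau i @` A).
Proof.
move=> cA; apply: compact_closed; first exact: metric_hausdorff.
apply: continuous_compact.
  by apply: continuous_subspaceT; exact: strict_contraction_continuous.
exact: subclosed_compact cA compactM _.
Qed.

Lemma range_tau_measurable i : measurable (range (tau i) : set (borel M)).
Proof.
by apply: closed_borel_measurable; apply: tau_image_closed; exact: closedT.
Qed.

(** Preimages of closed sets are finite unions of closed sets, so [sigma] is even
    continuous. *)
Lemma sigma_measurable :
  measurable_fun [set: borel M] (sigma : borel M -> borel M).
Proof.
apply: continuous_borel_measurable; apply/continuous_closedP => A cA.
rewrite sigma_preimage; last exact: closed_borel_measurable.
apply: closed_bigcup => [|i _]; first exact: finite_finset.
exact: tau_image_closed.
Qed.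

Lemma sigma_parametrizes : parametrizes mu (sigma : borel M -> borel M) 1 setT.
Proof.
split=> // [|A mA]; first exact: sigma_measurable.
have mS : measurable (sigma @^-1` A : set (borel M)).
  by rewrite -[X in measurable X]setTI; exact: sigma_measurable.
rewrite setIT mul1e; apply: (eq_trans _ (esym (ifs_mu mS))).
under eq_bigr => i _ do rewrite /pushforward -comp_preimage sigmaK preimage_id.
rewrite -ge0_sume_distrl; last by move=> i _; rewrite lee_fin ltW.
by rewrite sumEFin sum_p mul1e.
Qed.

(** The preimage by [tau j] of the range of [tau i] is that of the overlap of
    both ranges; its measure, weighted by [p j], is one of the nonnegative terms
    whose sum is the measure of that overlap. *)
Lemma tau_overlap_null i j : j != i ->
  mu ((tau j : borel M -> borel M) @^-1` range (tau i)) = 0%E.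
Proof.
move=> ji; have := overlap0 ji.
rewrite ifs_mu; last by apply: measurableI; exact: range_tau_measurable.
have ge0 k : (0 <= (p k)%:E * pushforward mu (tau k : borel M -> borel M)
    (range (tau j) `&` range (tau i)))%E.
  by apply: mule_ge0; [rewrite lee_fin ltW|rewrite /pushforward].
move=> /eqP; rewrite seq_psume_eq0// => /allP/(_ j (mem_index_enum j)) /=.
rewrite mule_eq0 eqe (gt_eqF (p_gt0 j)) /= => /eqP.
rewrite /pushforward preimage_setI.
by rewrite preimage_range setTI.
Qed.

(** In the invariance of [mu] applied to a part of the range of [tau i], the terms
    of the other maps vanish by [tau_overlap_null]. *)
Lemma tau_parametrizes i :
  parametrizes mu (tau i : borel M -> borel M) (p i) (range (tau i)).
Proof.
split=> //; first exact: tau_measurable.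
- exact: range_tau_measurable.
move=> A mA.
have mAi : measurable (A `&` range (tau i) : set (borel M)).
  by apply: measurableI => //; exact: range_tau_measurable.
apply: (eq_trans (ifs_mu mAi)).
rewrite (bigD1 i)//= big1 ?adde0; last first.
  move=> j ji; rewrite /pushforward preimage_setI.
  apply/eqP; rewrite mule_eq0; apply/orP; right.
  rewrite -measure_le0 -(tau_overlap_null ji).
  apply: le_measure; rewrite ?inE //.
  - apply: measurableI; rewrite -[X in measurable X]setTI;
      apply: tau_measurable => //.
    exact: range_tau_measurable.
  - rewrite -[X in measurable X]setTI; apply: tau_measurable => //.
    exact: range_tau_measurable.
by rewrite /pushforward preimage_setI preimage_range setIT.
Qed.


Lemma ae_tau_unique_range :
  {ae mu, forall x : borel M,
    forall i j y, x = tau i y -> range (tau j) x -> i = j}.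
Proof.
apply: filter_forall => i; apply: filter_forall => j.
have [->|ij] := eqVneq i j; first by apply/nearW.
exists (range (tau i) `&` range (tau j)); split.
- by apply: measurableI; exact: range_tau_measurable.
- exact: overlap0.
- move=> x /= /existsNP[y] /not_implyP[xy] /not_implyP[xj _].
  by split => //; exists y.
Qed.

Lemma range_tau_cover x : exists i y, x = tau i y.
Proof.
have : (sigma @^-1` [set: M]) x by [].
rewrite (sigma_preimage measurableT) => -[i _ [y _ <-]].
by exists i, y.
Qed.

(** * The operators of an iterated function system *)

Lemma ifs_S_L2 i : exists A : {linear L2 mu -> L2 mu}, forall f : L2fun mu,
  L2represents mu (ifs_S tau p sigma i f) (A (L2class f)).
Proof.
have mw : measurable_fun [set: borel M]
    (fun x : borel M => 1 / Num.sqrt (p i) * \1_(range (tau i)) x).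
  apply: measurable_funM; first exact: measurable_cst.
  by apply: measurable_indic; exact: range_tau_measurable.
have wK (x : borel M) :
    `|1 / Num.sqrt (p i) * \1_(range (tau i)) x| <= 1 / Num.sqrt (p i).
  rewrite normrM ger0_norm ?divr_ge0 ?sqrtr_ge0//.
  rewrite ler_piMr ?divr_ge0 ?sqrtr_ge0//.
  by rewrite indicE; case: (_ \in _); rewrite ?normr1 ?normr0.
have [A AE] := weighted_comp_L2 sigma_parametrizes mw wK.
exists A => f; have := AE f; congr L2represents; apply/funext => x.
by rewrite rmorphM.
Qed.

Lemma ifs_Sadj_L2 i : exists A : {linear L2 mu -> L2 mu}, forall f : L2fun mu,
  L2represents mu (ifs_Sadj tau p i f) (A (L2class f)).
Proof.
have mw : measurable_fun [set: borel M] (cst (Num.sqrt (p i))).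
  exact: measurable_cst.
have wK (x : borel M) : `|cst (Num.sqrt (p i)) x| <= Num.sqrt (p i).
  by rewrite ger0_norm ?sqrtr_ge0.
exact: (weighted_comp_L2 (tau_parametrizes i) mw wK).
Qed.

Variables S T : 'I_N -> {linear L2 mu -> L2 mu}.
Hypothesis SE : forall i (f : L2fun mu),
  L2represents mu (ifs_S tau p sigma i f) (S i (L2class f)).
Hypothesis TE : forall i (f : L2fun mu),
  L2represents mu (ifs_Sadj tau p i f) (T i (L2class f)).

Let sqrtp_neq0 i : (Num.sqrt (p i))%:C%C != 0 :> R[i].
Proof. by rewrite eq_complex /= eqxx andbT sqrtr_eq0 -ltNge. Qed.

Let div_sqrtpE i : (1 / Num.sqrt (p i))%:C%C = (Num.sqrt (p i))%:C%C^-1 :> R[i].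
Proof. by rewrite div1r fmorphV. Qed.

Let pE i : (p i)%:C%C = (Num.sqrt (p i))%:C%C ^+ 2 :> R[i].
Proof. by rewrite -rmorphXn /= sqr_sqrtr ?ltW. Qed.

Let invpE i : (p i)^-1%:C%C = (Num.sqrt (p i))%:C%C ^- 2 :> R[i].
Proof. by rewrite -pE; exact: (fmorphV (real_complex R)). Qed.

Let sigma_tau i x : sigma (tau i x) = x.
Proof. by rewrite -[LHS]/((sigma \o tau i) x) sigmaK. Qed.

Let conj_realM (a : R) (z : R[i]) : (a%:C%C * z)^*%C = a%:C%C * z^*%C.
Proof. by rewrite rmorphM; congr (_ * _); exact: conjc_real. Qed.

Lemma ifs_adjoint i : is_adjoint (L2dot mu) (S i) (T i).
Proof.
elim/L2ind => f; elim/L2ind => g.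
have [Sf SfE <-] := SE i f; have [Tg TgE <-] := TE i g.
have [mw wK] : measurable_fun [set: borel M] (cst (1 / Num.sqrt (p i))) /\
    forall x : borel M, `|cst (1 / Num.sqrt (p i)) x| <= 1 / Num.sqrt (p i).
  split; first exact: measurable_cst.
  by move=> x; rewrite ger0_norm ?divr_ge0 ?sqrtr_ge0.
(* [F] is [S i f] without its indicator function, which is left to the change
   of variables along [tau i]. *)
pose F := L2Fun (weighted_comp_sqint sigma_parametrizes mw wK f).
have FE x : F x = (1 / Num.sqrt (p i))%:C%C * f (sigma x) by [].
rewrite -[LHS]/(L2dot mu (L2class Sf) (L2class g)).
rewrite -[RHS]/(L2dot mu (L2class f) (L2class Tg)) !L2dotE.
transitivity (Cintegral mu (fun x => (\1_(range (tau i)) x)%:C%C *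
    (F x * (g x)^*%C))).
  congr Cintegral; apply/funext => x; rewrite -SfE FE /ifs_S.
  by rewrite !mulrA; congr (_ * _ * _); rewrite mulrC.
rewrite (dot_parametrizes (tau_parametrizes i)).
(* Moving the remaining scalars onto [f] turns [g \o tau i] into [T i g], and
   sesquilinearity then cancels them against the factor [p i]. *)
transitivity ((p i)%:C%C * L2dot mu ((p i)^-1%:C%C *: L2class f) (L2class Tg)).
  rewrite -linearZ L2dotE; congr (_ * Cintegral _ _); apply/funext => x.
  rewrite FE sigma_tau L2valZ -TgE /ifs_Sadj.
  rewrite div_sqrtpE invpE conj_realM.
  by move: (_%:C%C) (sqrtp_neq0 i) => s s0; field.
rewrite linearZl_LR /= L2dotE mulrA pE invpE divff ?mul1r//.
by rewrite expf_neq0.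
Qed.

Lemma ifs_orthogonal i j u : T i (S j u) = (i == j)%:R *: u.
Proof.
elim/L2ind: u => f.
have [g gE <-] := SE j f; have [h hE <-] := TE i g.
rewrite -linearZ; apply/L2classP.
have := ae_parametrizes (tau_parametrizes i) ae_tau_unique_range.
apply: filterS => x uniq_x.
rewrite L2valZ -hE /ifs_Sadj -gE /ifs_S sigma_tau indicE.
have [ij|ij] := eqVneq i j.
  rewrite -ij mem_set; last by exists x.
  by rewrite div_sqrtpE !mulr1n mulr1 mul1r mulrA divff// mul1r.
rewrite memNset ?mulr0 ?mul0r ?mulr0 ?mul0r//.
by move=> /(uniq_x i j x erefl)/eqP; apply/negP.
Qed.

Lemma ifs_complete u : \sum_(i < N) S i (T i u) = u.
Proof.
elim/L2ind: u => f.
have /choice[k kE] : forall i, exists k : L2fun mu,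
    L2class k = S i (T i (L2class f)) /\
    forall x, k x = (\1_(range (tau i)) x)%:C%C * f (tau i (sigma x)).
  move=> i; have [g gE <-] := TE i f; have [k kE <-] := SE i g.
  exists k; split=> // x; rewrite -kE /ifs_S -gE /ifs_Sadj div_sqrtpE.
  by move: (Num.sqrt (p i))%:C%C (sqrtp_neq0 i) => s s0; field.
under eq_bigr => i _ do rewrite -(kE i).1.
rewrite -linear_sum; apply/L2classP.
apply: filterS ae_tau_unique_range => x uniq_x.
have -> : (\sum_(i < N) k i) x = \sum_(i < N) k i x.
  by apply: (big_morph (fun h : L2fun mu => h x)).
have [i [y xE]] := range_tau_cover x.
rewrite (bigD1 i)//= big1 ?addr0; last first.
  move=> j ji; rewrite (kE j).2 indicE memNset ?mul0r//.
  by move=> /(uniq_x i j y xE)/esym/eqP; apply/negP.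
rewrite (kE i).2 indicE mem_set ?mul1r; last by exists y.
by rewrite xE sigma_tau.
Qed.

End iterated_function_system_operators.

Unset Implicit Arguments.
Set Strict Implicit.

Theorem proposition5p4 (R : realType) (M : pmetricType R) (N : nat)
    (tau : 'I_N -> M -> M) (p : 'I_N -> R) (sigma : M -> M)
    (mu : probability (borel M) R) :
  compact [set: M] ->
  (2 <= N)%N ->
  (forall i, strict_contraction (tau i)) ->
  (forall i, 0 < p i) ->
  \sum_(i < N) p i = 1 ->
  ifs_measure tau p mu ->
  (forall i j, i != j -> mu (range (tau i) `&` range (tau j)) = 0%E) ->
  (forall i, sigma \o tau i = id) ->
  (forall E : set (borel M), measurable E ->
    sigma @^-1` E = \bigcup_(i in [set: 'I_N]) (tau i @` E)) ->
  exists S Sadj : 'I_N -> {linear L2 mu -> L2 mu},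
    [/\ forall i (f : L2fun mu),
          L2represents mu (ifs_S tau p sigma i f) (S i (L2class f)),
        forall i (f : L2fun mu),
          L2represents mu (ifs_Sadj tau p i f) (Sadj i (L2class f)) &
        cuntz_rep (L2dot mu) S Sadj].
Proof.
move=> compactM _ contr p_gt0 sum_p ifs_mu overlap0 sigmaK sigma_preimage.
have [S SE] := choice (ifs_S_L2 compactM contr p_gt0 sum_p ifs_mu sigmaK
  sigma_preimage).
have [T TE] := choice (ifs_Sadj_L2 compactM contr p_gt0 ifs_mu overlap0).
exists S, T; split => //; apply: cuntz_rep_of_relations.
- exact: (ifs_adjoint compactM contr p_gt0 sum_p ifs_mu overlap0 sigmaK
    sigma_preimage SE TE).
- exact: (ifs_orthogonal compactM contr p_gt0 ifs_mu overlap0 sigmaK SE TE).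
- exact: (ifs_complete compactM contr p_gt0 overlap0 sigmaK sigma_preimage
    SE TE).
Qed.
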